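(* Let $k\ge2$ and let $A$ be a path-connected topological group with an action of $G$ via topological group homomorphisms. Then $$\mathrm{TC}_{k,G}^{\#}(A)=\mathrm{cat}_G^{\#}(A^{k-1}),$$ where $G$ acts diagonally on $A^{k-1}$.
   Context: $A$ is a $G$-space such that each $g\in G$ acts on $A$ by a continuous group homomorphism. For a $G$-space $Y$, $\mathrm{cat}_G^{\#}(Y)$ is the smallest $n$ such that $Y$ has an open cover by $n$ $G$-invariant sets each of whose inclusions into $Y$ is null-homotopic (non-equivariantly). $X^I$ is the space of paths $[0,1]\to X$ with the compact-open topology, $e_{k,X}\colon X^I\to X^k$ is $e_{k,X}(\alpha)=\left(\alpha(0),\alpha(\tfrac1{k-1}),\dots,\alpha(\tfrac{k-2}{k-1}),\alpha(1)\right)$, and $\mathrm{TC}_{k,G}^{\#}(X)$ is the smallest $n$ such that $X^k$ has an open cover by $n$ sets invariant under the diagonal $G$-action, over each of which $e_{k,X}$ has a continuous (not necessarily equivariant) section. Each invariant is $\infty$ if no such $n$ exists. *)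

(* Defs.v *)
From HB Require Import structures.
From mathcomp Require Import all_boot all_order all_algebra.
From mathcomp Require Import all_classical all_reals.
From mathcomp Require Import topology normedtype homotopy.

Set Implicit Arguments.
Unset Strict Implicit.
Unset Printing Implicit Defensive.

Import Order.TTheory GRing.Theory Num.Theory.
Import numFieldNormedType.Exports.

Local Open Scope classical_set_scope.
Local Open Scope ring_scope.

HB.structure Definition PreTopologicalGroup := {G of Topological G & Group G}.

HB.mixin Record PreTopologicalGroup_isTopologicalGroup G
    & PreTopologicalGroup G := {
  mulg_continuous : continuous (fun x : G * G => (x.1 * x.2)%g);
  invg_continuous : continuous (fun x : G => x^-1%g)
}.

#[short(type="topologicalGroupType")]
HB.structure Definition TopologicalGroup :=
  {G of PreTopologicalGroup G & PreTopologicalGroup_isTopologicalGroup G}.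

Structure gspace (G : topologicalGroupType) (Y : topologicalType) := GSpace {
  gact :> G -> Y -> Y;
  gact_continuous : continuous (fun p : G * Y => gact p.1 p.2);
  gact1 : forall y, gact 1%g y = y;
  gactM : forall g h y, gact (g * h)%g y = gact g (gact h y)
}.

Section diagonal_action.
Context (G : topologicalGroupType) (X : topologicalType) (a : gspace G X).
Variable n : nat.

Definition diag_act (g : G) (x : {ptws 'I_n -> X}) : {ptws 'I_n -> X} :=
  fun i => a g (x i).

Lemma diag_act_continuous :
  continuous (fun p : G * {ptws 'I_n -> X} => diag_act p.1 p.2).
Proof.
move=> [g x]; apply/cvg_sup => i; apply/cvg_image.
  apply/seteqP; split=> // y _; exists (fun=> y) => //.
suff : (fun p : G * {ptws 'I_n -> X} => diag_act p.1 p.2 i) @ nbhs (g, x)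
    --> a g (x i).
  move=> h U /h /= nU.
  exists ((fun f : {ptws 'I_n -> X} => f i) @^-1` U) => //.
  by rewrite image_preimage// -subTset => y _; exists (fun=> y).
have := @gact_continuous _ _ a (g, x i).
apply: (@cvg_comp _ _ _
  (fun p : G * {ptws 'I_n -> X} => (p.1, p.2 i))
  (fun p : G * X => a p.1 p.2)).
apply: cvg_pair => /=; first exact: cvg_fst.
apply: (@cvg_comp _ _ _ snd (fun f : {ptws 'I_n -> X} => f i)).
  exact: cvg_snd.
exact: (@proj_continuous _ (fun=> X) i).
Qed.

Lemma diag_act1 x : diag_act 1%g x = x.
Proof. by apply/funext => i; exact: gact1. Qed.

Lemma diag_actM g h x : diag_act (g * h)%g x = diag_act g (diag_act h x).
Proof. by apply/funext => i; exact: gactM. Qed.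

Definition diag_gspace : gspace G {ptws 'I_n -> X} :=
  GSpace diag_act_continuous diag_act1 diag_actM.

End diagonal_action.

Definition unit_interval (R : realType) : Type := set_type `[0 : R, 1]%classic.

Section unit_interval.
Variable R : realType.

HB.instance Definition _ :=
  Topological.copy (unit_interval R) (set_type `[0 : R, 1]%classic).

(* The point i/(k-1) of [0,1]. *)
Lemma subdivision_subproof k (i : 'I_k) :
  i%:R / k.-1%:R \in (`[0 : R, 1]%classic : set R).
Proof.
rewrite inE /= in_itv /= divr_ge0 ?ler0n//=.
have [->|k0] := eqVneq k.-1 0%N; first by rewrite invr0 mulr0 ler01.
rewrite ler_pdivrMr ?ltr0n ?lt0n// mul1r ler_nat -ltnS prednK//.
by case: k k0 {i} => //.
Qed.

Definition subdivision k (i : 'I_k) : unit_interval R :=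
  exist _ (i%:R / k.-1%:R) (subdivision_subproof i).

Lemma zero_subproof : 0 \in (`[0 : R, 1]%classic : set R).
Proof. by rewrite inE /= in_itv /= lexx ler01. Qed.

Lemma one_subproof : 1 \in (`[0 : R, 1]%classic : set R).
Proof. by rewrite inE /= in_itv /= lexx ler01. Qed.

Lemma zero_neq_one_subproof :
  (exist _ 0 zero_subproof : unit_interval R) != exist _ 1 one_subproof.
Proof. by apply/eqP => -[] /eqP; rewrite eq_sym oner_eq0. Qed.

HB.instance Definition _ :=
  isBiPointed.Build (unit_interval R) zero_neq_one_subproof.

End unit_interval.

(* The library's topology on continuousType is not global; this is X^I with
   the compact-open topology. *)
Definition path_space (R : realType) (X : topologicalType) : Type :=
  continuousType (unit_interval R) X.

HB.instance Definition _ (R : realType) (X : topologicalType) :=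
  Choice.copy (path_space R X) (continuousType (unit_interval R) X).
HB.instance Definition _ (R : realType) (X : topologicalType) :=
  Topological.copy (path_space R X)
    (@initial_topology (path_space R X) {compact-open, unit_interval R -> X}
      id).

Definition path_connected (R : realType) (X : topologicalType) : Prop :=
  [set: X] !=set0 /\
  forall x y : X, inhabited {path unit_interval R from x to y in X}.

Definition homotopic (R : realType) (S T : topologicalType) (f g : S -> T) :
    Prop :=
  exists H : S * unit_interval R -> T,
    [/\ continuous H,
        forall s, H (s, zero) = f s &
        forall s, H (s, one) = g s].

Definition null_homotopic (R : realType) (S T : topologicalType) (f : S -> T) :
    Prop :=
  exists t : T, homotopic R f (cst t).

Definition invariant_set (G : topologicalGroupType) (Y : topologicalType)
    (a : gspace G Y) (U : set Y) : Prop :=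
  forall g y, U y -> U (a g y).

Definition invariant_open_cover (G : topologicalGroupType)
    (Y : topologicalType) (a : gspace G Y) (n : nat) (U : 'I_n -> set Y) :
    Prop :=
  [/\ forall i, open (U i),
      forall i, invariant_set a (U i) &
      \bigcup_i U i = [set: Y]].

(* \bar nat stands for N together with +oo; -oo is never a value. *)
Definition least_nat (P : nat -> Prop) : \bar nat :=
  match pselect (exists n, `[< P n >]) with
  | left exP => (ex_minn exP)%:E
  | right _ => +oo%E
  end.

Definition cat_sharp (R : realType) (G : topologicalGroupType)
    (Y : topologicalType) (a : gspace G Y) : \bar nat :=
  least_nat (fun n => exists U : 'I_n -> set Y,
    invariant_open_cover a U /\
    forall i, null_homotopic R (set_val : U i -> Y)).

(* The fibration e_{k,X}, sending a path to its values at the points i/(k-1),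
   0 <= i <= k-1. *)
Definition path_eval (R : realType) (k : nat) (X : topologicalType)
    (alpha : path_space R X) : {ptws 'I_k -> X} :=
  fun i => alpha (subdivision R i).

Definition has_local_section (S T : topologicalType) (p : S -> T)
    (U : set T) : Prop :=
  exists s : U -> S, continuous s /\ forall u : U, p (s u) = set_val u.

Definition TC_sharp (R : realType) (k : nat) (G : topologicalGroupType)
    (X : topologicalType) (a : gspace G X) : \bar nat :=
  least_nat (fun n => exists U : 'I_n -> set {ptws 'I_k -> X},
    invariant_open_cover (diag_gspace a k) U /\
    forall i, has_local_section (@path_eval R k X) (U i)).

(* Main.v *)
From HB Require Import structures.
Require Import Defs.
From mathcomp Require Import all_boot all_order all_algebra.
From mathcomp Require Import all_classical all_reals.
From mathcomp Require Import topology normedtype homotopy.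

(** Write m = k - 1.  The two invariants agree because the same numbers n are
    admissible for both: a cover of A^(m+1) by n sets with sections and a cover
    of A^m by n sets with null-homotopic inclusions can be turned into one
    another by taking preimages along two equivariant maps,

      cons_one      : A^m -> A^(m+1),  x |-> (1, x_1, ..., x_m),
      left_quotient : A^(m+1) -> A^m,  y |-> (y_0^-1 y_1, ..., y_0^-1 y_m).

    They are equivariant because G acts by group homomorphisms, and
    preimages of invariant open covers along continuous equivariant maps are
    invariant open covers ([invariant_open_cover_preimage]).

    From sections to contractions ([null_homotopic_of_section]).  A section over
    U sends (1, x) to a path through 1, x_1, ..., x_m in this order.  Each point
    x_l can slide back along that path to 1; doing this simultaneously for all l
    contracts the preimage of U in A^m.

    From contractions to sections ([section_of_null_homotopic]).  Since A is a
    path-connected group, a null-homotopy of the inclusion of V can be replaced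
    by a homotopy D from the constant tuple 1 to the inclusion
    ([null_homotopic_from_one]).  For y with x = left_quotient y in V, the path

      t |-> y_0 * prod_l D(x, hat_l(t))_l

    where hat_l is the piecewise linear function equal to 1 at the node (l+1)/m
    and to 0 at the other nodes, passes through y_0, y_0 x_1 = y_1, ...,
    y_0 x_m = y_m.  The group law thus replaces any concatenation of paths.

    The passage between paths depending continuously on a parameter and
    continuous functions of the parameter and the time is the exponential law
    for the compact-open topology, which holds as [0,1] is compact and regular
    ([continuous_path_eval], [path_space_curry]). *)

Set Implicit Arguments.
Unset Strict Implicit.
Unset Printing Implicit Defensive.

Import Order.TTheory GRing.Theory Num.Theory.
Import numFieldNormedType.Exports.

Local Open Scope classical_set_scope.
Local Open Scope ring_scope.

(** * Continuity of maps into pairs, products and subsets *)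

Lemma continuous_pair (T X Y : topologicalType) (f : T -> X) (g : T -> Y) :
  continuous f -> continuous g -> continuous (fun t => (f t, g t)).
Proof. by move=> cf cg t; apply: cvg_pair; [exact: cf|exact: cg]. Qed.

Lemma continuous_compose (T X Y : topologicalType) (f : X -> Y) (g : T -> X) :
  continuous f -> continuous g -> continuous (fun t => f (g t)).
Proof. by move=> cf cg t; apply: continuous_comp; [exact: cg|exact: cf]. Qed.

Lemma continuous_fst (X Y : topologicalType) :
  continuous (fst : X * Y -> X).
Proof. by move=> [x y]; exact: cvg_fst. Qed.

Lemma continuous_snd (X Y : topologicalType) :
  continuous (snd : X * Y -> Y).
Proof. by move=> [x y]; exact: cvg_snd. Qed.

Lemma continuous_subr (R : realType) (T : topologicalType) (f g : T -> R) :
  continuous f -> continuous g -> continuous (fun t => f t - g t).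
Proof. by move=> cf cg t; exact: (@cvgB R R^o _ _ _ f g _ _ (cf t) (cg t)). Qed.

Lemma continuous_mulr (R : realType) (T : topologicalType) (f g : T -> R) :
  continuous f -> continuous g -> continuous (fun t => f t * g t).
Proof. by move=> cf cg t; exact: (@cvgM R _ _ _ f g _ _ (cf t) (cg t)). Qed.

Lemma continuous_set_val (X : topologicalType) (U : set X) :
  continuous (set_val : U -> X).
Proof. exact: initial_continuous. Qed.

Lemma continuous_ptws (T X : topologicalType) (I : Type)
    (f : T -> {ptws I -> X}) :
  (forall i, continuous (fun t => f t i)) -> continuous f.
Proof.
move=> cf t; apply/cvg_sup => i.
exact: (@continuous_comp_initial _ _ _
  (fun x : {ptws I -> X} => x i) f (cf i)).
Qed.

Lemma continuous_ptws_coord (T X : topologicalType) (I : eqType) (i : I)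
    (f : T -> {ptws I -> X}) :
  continuous f -> continuous (fun t => f t i).
Proof.
exact: (@continuous_compose _ _ _ (fun x : {ptws I -> X} => x i) f
  (@proj_continuous _ (fun=> X) i)).
Qed.

(** * Preimages of sets and of invariant covers *)

(** The restriction of [f] to the preimage of [U], with values in the subspace
    [U]: sections and homotopies are only defined on subspaces, and this is how
    they are pulled back along [f]. *)
Definition preimage_map (Y Z : Type) (f : Y -> Z) (U : set Z)
    (y : f @^-1` U) : U :=
  exist _ (f (set_val y)) (mem_set (set_mem (valP y) : U (f (set_val y)))).

Lemma continuous_preimage_map (Y Z : topologicalType) (f : Y -> Z)
    (U : set Z) : continuous f -> continuous (@preimage_map Y Z f U).
Proof.
move=> cf; apply: (@continuous_comp_initial _ _ _ (set_val : U -> Z)).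
exact: continuous_compose cf (@continuous_set_val _ _).
Qed.

Lemma invariant_open_cover_preimage (G : topologicalGroupType)
    (Y Z : topologicalType) (a : gspace G Y) (b : gspace G Z) (f : Y -> Z)
    (n : nat) (U : 'I_n -> set Z) :
  continuous f -> (forall g y, f (a g y) = b g (f y)) ->
  invariant_open_cover b U -> invariant_open_cover a (fun i => f @^-1` U i).
Proof.
move=> cf fE [oU iU cU]; split.
- by move=> i; apply: open_comp => // y _; exact: cf.
- by move=> i g y /= Uy; rewrite fE; exact: iU.
- by rewrite -preimage_bigcup cU preimage_setT.
Qed.

(** * The unit interval and the exponential law *)

Section unit_interval_topology.
Variable R : realType.
Local Notation I := (unit_interval R).

Lemma clamp_subproof (x : R) :
  Num.max 0 (Num.min x 1) \in (`[0 : R, 1]%classic : set R).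
Proof.
by rewrite inE /= in_itv /= le_max lexx /= ge_max ler01 ge_min lexx orbT.
Qed.

(** The retraction of the line onto [0,1]: it makes real formulas into maps to
    [0,1] without a proof that they stay there. *)
Definition clamp (x : R) : I :=
  exist _ (Num.max 0 (Num.min x 1)) (clamp_subproof x).

Lemma clamp_val (t : I) : clamp (set_val t) = t.
Proof.
apply: val_inj => /=; case: t => x /=; rewrite set_valE/= inE/= in_itv/=.
by case/andP => x0 x1; rewrite min_l// max_r.
Qed.

Lemma clamp_ge1 (x : R) : 1 <= x -> clamp x = one.
Proof. by move=> x1; apply: val_inj; rewrite /= min_r// max_r. Qed.

Lemma clamp_le0 (x : R) : x <= 0 -> clamp x = zero.
Proof.
move=> x0; apply: val_inj; rewrite /= max_l// ge_min.
by rewrite x0.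
Qed.

Lemma continuous_clamp : continuous clamp.
Proof.
have cm : continuous (fun x : R => Num.max 0 (Num.min x 1)).
  move=> x.
  have c1 : {for x, continuous ((id : R -> R^o) \min cst 1)}.
    by apply: continuous_min; [exact: cvg_id|exact: cst_continuous].
  exact: continuous_max (@cst_continuous _ _ (0 : R^o) x) c1.
exact: (@continuous_comp_initial _ _ _ (set_val : I -> R) clamp cm).
Qed.

(** The interval, as a space of its own, is the image of the compact segment of
    the line under the retraction [clamp], hence compact. *)
Lemma unit_interval_locally_compact : locally_compact [set: I].
Proof.
have cI : compact [set: I].
  rewrite (_ : [set: I] = clamp @` `[0, 1]).
    apply: continuous_compact; last exact: segment_compact.
    exact/continuous_subspaceT/continuous_clamp.
  apply/seteqP; split => // t _; exists (set_val t); last exact: clamp_val.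
  by have /set_mem := valP t.
move=> t _; exists setT; first exact: filterT.
by split => //; exact: closedT.
Qed.

(** A subspace of a uniform space is uniform, hence regular. *)
Lemma unit_interval_regular : regular_space I.
Proof. exact: (@uniform_regular (set_type (`[0 : R, 1]%classic))). Qed.

(** Evaluation is jointly continuous because [0,1] is locally compact and
    regular. *)
Lemma continuous_path_eval (T X : topologicalType) (s : T -> path_space R X)
    (u : T -> I) :
  continuous s -> continuous u -> continuous (fun t => s t (u t)).
Proof.
move=> cs cu.
have cE : continuous (uncurry (fun t : T => s t : I -> X)).
  apply: continuous_uncurry_regular.
  - exact: unit_interval_locally_compact.
  - exact: unit_interval_regular.
  - apply: (@continuous_compose _ (path_space R X) {compact-open, I -> X} id s);
      last exact: cs.
    exact: initial_continuous.
  - by move=> t; exact: cts_fun.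
have ctu : continuous (fun t => (t, u t)).
  by apply: continuous_pair cu => t; exact: cvg_id.
exact: continuous_compose cE ctu.
Qed.

(** Currying is continuous for any parameter space [T]; this reduces the
    continuity of a family of paths to that of a map of two variables. *)
Lemma path_space_curry (T X : topologicalType) (f : T * I -> X) :
  continuous f ->
  exists s : T -> path_space R X,
    continuous s /\ forall t u, s t u = f (t, u).
Proof.
move=> cf.
have cft t : continuous (fun u => f (t, u)) by
  have [_] := continuous_curry cf; exact.
pose s t : path_space R X :=
  HB.pack_for (continuousType I X) (fun u => f (t, u))
    (@isContinuous.Build I X _ (cft t)).
exists s; split => //.
apply: continuous_comp_initial.
exact: (continuous_curry_fun cf).
Qed.

End unit_interval_topology.

(** * Null-homotopies in powers of a path-connected group *)

Section group_valued_maps.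
Variable A : topologicalGroupType.

Lemma continuous_mulg (T : topologicalType) (f g : T -> A) :
  continuous f -> continuous g -> continuous (fun t => f t * g t)%g.
Proof.
move=> cf cg.
have cfg : continuous (fun t => (f t, g t)) by exact: continuous_pair.
exact: continuous_compose (@mulg_continuous A) cfg.
Qed.

Lemma continuous_invg (T : topologicalType) (f : T -> A) :
  continuous f -> continuous (fun t => (f t)^-1)%g.
Proof. by move=> cf; exact: (continuous_compose (@invg_continuous A) cf). Qed.

(** Given a homotopy [H] from [f] to a constant [c] and paths [gamma i] from
    [1] to [c i], the pointwise product of [gamma i], the constant [(c i)^-1]
    and the reverse of [H] starts at [1 * c^-1 * c = 1] and ends at
    [c * c^-1 * f = f].
    Multiplying in the group does what concatenating [gamma] with the reverse of
    [H] would do, in a single formula. *)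
Lemma null_homotopic_from_one (R : realType) (S : topologicalType)
    (I : eqType) (f : S -> {ptws I -> A}) :
  path_connected R A -> null_homotopic R f ->
  homotopic R (cst ((fun=> 1%g) : {ptws I -> A})) f.
Proof.
move=> [_ Apc] [c [H [cH H0 H1]]].
have /choice [gamma /all_and3[cgamma gamma0 gamma1]] (i : I) :
    exists g : unit_interval R -> A,
      [/\ continuous g, g zero = 1%g & g one = c i].
  have [g] := Apc 1%g (c i); exists g.
  by split; [exact: cts_fun|exact: path_zero|exact: path_one].
pose rev (t : unit_interval R) := clamp (1 - set_val t).
have crev : continuous rev.
  apply: (@continuous_compose _ _ _ (@clamp R)); first exact: continuous_clamp.
  apply: continuous_subr; first exact: cst_continuous.
  exact: (@continuous_set_val R `[0 : R, 1]%classic).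
have rev0 : rev zero = one by apply: clamp_ge1; rewrite /= subr0.
have rev1 : rev one = zero by apply: clamp_le0; rewrite /= subrr.
exists (fun x i => gamma i x.2 * (c i)^-1 * H (x.1, rev x.2) i)%g; split.
- apply: continuous_ptws => i; apply: continuous_mulg.
    apply: continuous_mulg; last exact: cst_continuous.
    exact: (continuous_compose (cgamma i) (@continuous_snd _ _)).
  apply: (continuous_ptws_coord (f := fun x => H (x.1, rev x.2))).
  apply: (continuous_compose (g := fun x => (x.1, rev x.2)) cH).
  apply: (continuous_pair (f := fst)); first exact: continuous_fst.
  exact: (continuous_compose crev (@continuous_snd _ _)).
- by move=> s; apply/funext => i /=; rewrite gamma0 rev0 H1 mul1g mulVg.
- by move=> s; apply/funext => i /=; rewrite gamma1 rev1 H0 mulgV mul1g.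
Qed.

End group_valued_maps.

(** * The two equivariant maps between A^m and A^(m+1) *)

Section power_shift.
Variables (A : topologicalGroupType) (m : nat).

Definition cons_one (x : {ptws 'I_m -> A}) : {ptws 'I_m.+1 -> A} :=
  fun i => if unlift ord0 i is Some l then x l else 1%g.

Definition left_quotient (y : {ptws 'I_m.+1 -> A}) : {ptws 'I_m -> A} :=
  fun l => ((y ord0)^-1 * y (lift ord0 l))%g.

Lemma continuous_cons_one : continuous cons_one.
Proof.
apply: continuous_ptws => i; rewrite /cons_one.
case: unlift => [l|]; last exact: cst_continuous.
exact: (@proj_continuous _ (fun=> A) l).
Qed.

Lemma continuous_left_quotient : continuous left_quotient.
Proof.
apply: continuous_ptws => l; apply: continuous_mulg.
  exact/continuous_invg/(@proj_continuous _ (fun=> A) ord0).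
exact: (@proj_continuous _ (fun=> A) (lift ord0 l)).
Qed.

Section equivariance.
Variables (G : topologicalGroupType) (a : gspace G A).
Hypothesis a_hom : forall (g : G) (x y : A), a g (x * y)%g = (a g x * a g y)%g.

Lemma action_one g : a g 1%g = 1%g.
Proof. by apply: (mulgI (a g 1%g)); rewrite -a_hom !mulg1. Qed.

Lemma action_inv g x : a g (x^-1)%g = (a g x)^-1%g.
Proof. by apply: (mulgI (a g x)); rewrite -a_hom !mulgV action_one. Qed.

Lemma cons_one_equivariant g x :
  cons_one (diag_gspace a m g x) = diag_gspace a m.+1 g (cons_one x).
Proof.
apply/funext => i; rewrite /= /diag_act /cons_one.
by case: unlift => // ; rewrite action_one.
Qed.

Lemma left_quotient_equivariant g y :
  left_quotient (diag_gspace a m.+1 g y) =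
  diag_gspace a m g (left_quotient y).
Proof.
by apply/funext => l; rewrite /= /diag_act /left_quotient a_hom action_inv.
Qed.

End equivariance.
End power_shift.

(** * Sections against contractions *)

Section sections_and_contractions.
Variables (R : realType) (A : topologicalGroupType) (m : nat).
Hypothesis m_gt0 : (0 < m)%N.
Local Notation I := (unit_interval R).

(** The [l]-th coordinate [x l] of [x] is the value at time [(l+1)/m] of the
    path that the section attaches to [(1, x)], and the value at time [0] is
    [1]; it is moved to [1] by letting the time decrease linearly to [0]. *)
Lemma null_homotopic_of_section (U : set {ptws 'I_m.+1 -> A}) :
  has_local_section (@path_eval R m.+1 A) U ->
  null_homotopic R (set_val : (@cons_one A m) @^-1` U -> {ptws 'I_m -> A}).
Proof.
move=> [s [cs sE]]; exists (fun=> 1%g).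
pose j := @preimage_map _ _ (@cons_one A m) U.
have sjE x i : s (j x) (subdivision R i) = cons_one (set_val x) i.
  by have /(congr1 (fun y => y i)) := sE (j x).
pose sigma (l : 'I_m) (t : I) : I :=
  clamp ((1 - set_val t) * (l.+1%:R / m%:R)).
exists (fun x l => s (j x.1) (sigma l x.2)); split.
- apply: continuous_ptws => l; apply: continuous_path_eval.
    apply: (continuous_compose cs).
    apply: (@continuous_compose _ _ _ j fst); last exact: continuous_fst.
    exact/continuous_preimage_map/continuous_cons_one.
  apply: (@continuous_compose _ _ _ (@clamp R)); first exact: continuous_clamp.
  apply: continuous_mulr; last exact: cst_continuous.
  apply: continuous_subr; first exact: cst_continuous.
  apply: (@continuous_compose _ _ _ (set_val : I -> R) snd).
    exact: (@continuous_set_val R `[0 : R, 1]%classic).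
  exact: continuous_snd.
- move=> x; apply/funext => l /=.
  (* At time 0 the clamped parameter is the node (l+1)/m, of index l+1. *)
  have -> : sigma l zero = subdivision R (lift ord0 l).
    by rewrite -[RHS]clamp_val /sigma /= subr0 mul1r.
  by rewrite sjE /cons_one liftK.
- move=> x; apply/funext => l /=.
  have -> : sigma l one = subdivision R (@ord0 m).
    rewrite /sigma clamp_le0; first by apply: val_inj; rewrite /= mul0r.
    by rewrite /= subrr mul0r.
  by rewrite sjE /cons_one unlift_none.
Qed.

(** The hat function of the node [(l+1)/m]; [clamp] cuts off its negative part.
*)
Definition hat (l : 'I_m) (t : I) : I :=
  clamp (1 - `|m%:R * set_val t - l.+1%:R|).

Lemma continuous_hat l : continuous (hat l).
Proof.
apply: (@continuous_compose _ _ _ (@clamp R)); first exact: continuous_clamp.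
apply: continuous_subr; first exact: cst_continuous.
apply: (@continuous_compose _ _ _ (fun x : R => `|x|)).
  exact: (@norm_continuous R R^o).
apply: continuous_subr; last exact: cst_continuous.
apply: continuous_mulr; first exact: cst_continuous.
exact: (@continuous_set_val R `[0 : R, 1]%classic).
Qed.

(** Away from its own node, [m] times the distance of two nodes is a positive
    integer, so the value before [clamp] is at most [0]. *)
Lemma hat_subdivision l (i : 'I_m.+1) :
  hat l (subdivision R i) = if i == lift ord0 l then one else zero.
Proof.
rewrite /hat /= mulrCA divff ?pnatr_eq0 -?lt0n// mulr1.
case: eqVneq => [->|il].
  by apply: clamp_ge1; rewrite lift0 subrr normr0 subr0.
apply: clamp_le0; rewrite subr_le0.
have {il} : nat_of_ord i != l.+1 by rewrite -lift0.
rewrite neq_ltn => /orP[] lt.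
  by rewrite distrC ler_normr lerBrDr addrC natr1 ler_nat lt.
by rewrite ler_normr lerBrDr addrC natr1 ler_nat lt.
Qed.

(** At the node [i/m] all hat functions vanish except the one of [i], so the
    product over [l] reduces to the factor [D (q y, one)], which is
    [(y 0)^-1 * y i], or to [1] if [i = 0]. *)
Lemma section_of_null_homotopic (V : set {ptws 'I_m -> A}) :
  path_connected R A ->
  null_homotopic R (set_val : V -> {ptws 'I_m -> A}) ->
  has_local_section (@path_eval R m.+1 A) ((@left_quotient A m) @^-1` V).
Proof.
move=> Apc /(null_homotopic_from_one Apc)[D [cD D0 D1]].
set W := _ @^-1` V.
pose q := @preimage_map _ _ (@left_quotient A m) V.
pose F (x : W * I) : A :=
  (set_val x.1 ord0 * \prod_(l < m) D (q x.1, hat l x.2) l)%g.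
have cF : continuous F.
  apply: continuous_mulg.
    apply: (continuous_ptws_coord (f := fun x : W * I => set_val x.1)).
    apply: (@continuous_compose _ _ _ (set_val : W -> {ptws 'I_m.+1 -> A}) fst).
      exact: continuous_set_val.
    exact: continuous_fst.
  apply: (continuous_big (@mulg_continuous A)) => l _.
  apply: (continuous_ptws_coord (f := fun x => D (q x.1, hat l x.2))).
  apply: (continuous_compose (g := fun x => (q x.1, hat l x.2)) cD).
  apply: (continuous_pair (f := fun x => q x.1)).
    apply: (@continuous_compose _ _ _ q fst); last exact: continuous_fst.
    exact/continuous_preimage_map/continuous_left_quotient.
  exact: (continuous_compose (@continuous_hat l) (@continuous_snd _ _)).
have [s [cs sE]] := path_space_curry cF.
exists s; split => // u; apply/funext => i; rewrite /path_eval sE /F /=.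
case: (unliftP ord0 i) => [l|] ->.
  rewrite (big_only1 l)//= => [|l' ll' _]; rewrite hat_subdivision.
    by rewrite eqxx D1 /q /left_quotient /= mulVKg.
  by rewrite (inj_eq lift_inj) eq_sym (negbTE ll') D0.
rewrite big1 ?mulg1// => l _.
by rewrite hat_subdivision (negbTE (neq_lift _ _)) D0.
Qed.

End sections_and_contractions.

(** * The equality of the two invariants *)

Lemma least_nat_ext (P Q : nat -> Prop) :
  (forall n, P n <-> Q n) -> least_nat P = least_nat Q.
Proof. by move=> PQ; congr least_nat; apply/funext => n; apply/propext. Qed.

Theorem theorem3p36 (R : realType) (k : nat) (k_ge2 : (2 <= k)%N)
    (G A : topologicalGroupType) (a : gspace G A)
    (a_hom : forall (g : G) (x y : A), a g (x * y)%g = (a g x * a g y)%g)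
    (A_path_connected : path_connected R A) :
  TC_sharp R k a = cat_sharp R (diag_gspace a k.-1).
Proof.
case: k k_ge2 => // m m_gt0; apply: least_nat_ext => n; split => -[U [cU sU]].
- exists (fun i => (@cons_one A m) @^-1` U i); split; last first.
    by move=> i; exact: null_homotopic_of_section.
  apply: invariant_open_cover_preimage cU; first exact: continuous_cons_one.
  exact: cons_one_equivariant.
- exists (fun i => (@left_quotient A m) @^-1` U i); split; last first.
    by move=> i; exact: section_of_null_homotopic.
  apply: invariant_open_cover_preimage cU.
    exact: continuous_left_quotient.
  exact: left_quotient_equivariant.
Qed.
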